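(* Let $(\Omega,\mathcal F,\mathbb P)$ be a standard atomless probability space and $\mathcal X=L^\infty(\Omega,\mathcal F,\mathbb P)$. Let $c:\mathbb R\to\mathbb R$ be strictly increasing and continuous, let $h:[0,1]\to[0,1]$ be continuous and nondecreasing with $h(0)=0$ and $h(1)=1$, and let $\rho_c^h:\mathcal X\to\mathbb R$ be the rank-dependent expected utility $$\rho_c^h(X)=c^{-1}\!\left(\int_{-\infty}^0\big[h(\mathbb P(c(X)>x))-1\big]\,dx+\int_0^\infty h(\mathbb P(c(X)>x))\,dx\right).$$ Then: (i) $\rho_c^h$ is translation invariant if and only if, up to a positive affine transformation, $c$ is an exponential function or the identity; that is, if and only if there are $a>0$ and $b\in\mathbb R$ such that either $c(x)=ax+b$ for all $x\in\mathbb R$, or, for some $\beta\ne0$, $c(x)=a\,\frac{e^{\beta x}-1}{\beta}+b$ for all $x\in\mathbb R$. (ii) $\rho_c^h$ is additive consistent if and only if $h(x)=x$ for all $x\in[0,1]$ and $c$ is, up to a positive affine transformation, an exponential function or the identity in the sense of (i). Thus the only maps $\rho_c^h$ that are additive consistent are the entropic risk measures $\rho_\beta^{ent}(X)=\frac1\beta\ln(\mathbb E(e^{\beta X}))$ for $\beta\in\mathbb R\setminus\{0\}$ and $\rho_0^{ent}(X)=\mathbb E(X)$.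
   Context: A map $\rho:\mathcal X\to\mathbb R$ is translation invariant if $\rho(X+m)=\rho(X)+m$ for all $X\in\mathcal X$, $m\in\mathbb R$. It is additive consistent if for all $X,Y,Z\in\mathcal X$ such that $Z$ is independent of the pair $(X,Y)$, one has $\rho(X)\le\rho(Y)\Rightarrow\rho(X+Z)\le\rho(Y+Z)$. The map $\rho_c^h$ does not change if $c$ is replaced by $ac+b$ with $a>0$, $b\in\mathbb R$. *)

(* Defs.v *)
From HB Require Import structures.
From mathcomp Require Import all_boot all_order all_algebra.
From mathcomp Require Import all_classical all_reals all_analysis.
From mathcomp Require Import measurable_realfun.

Set Implicit Arguments.
Unset Strict Implicit.
Unset Printing Implicit Defensive.

Import Order.TTheory GRing.Theory Num.Theory.
Import numFieldNormedType.Exports.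

Local Open Scope classical_set_scope.
Local Open Scope ring_scope.

Section probability_space.
Context d (T : measurableType d) (R : realType).
Variable P : probability T R.

(* Isomorphic mod 0 to a Borel probability measure on the real line: off a null
   set N, f is injective and Borel, and its inverse is measurable up to null
   sets of the image measure.  Images are only required to lie in the completed
   Borel sigma-algebra, so that both complete (Lebesgue-Rokhlin) spaces and
   standard Borel spaces with a Borel probability measure qualify. *)
Definition standard_space : Prop :=
  exists (N : set T) (f : T -> R),
    [/\ measurable N, P N = 0%E, measurable_fun setT f,
        {in ~` N &, injective f} &
        forall A : set T, measurable A -> A `<=` ~` N ->
          completed_algebra_gen (pushforward P f) (f @` A)].

Definition atomless : Prop :=
  forall A : set T, measurable A -> (0 < P A)%E ->
    exists B : set T, [/\ measurable B, B `<=` A, (0 < P B)%E & (P B < P A)%E].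

Definition independent_rv d1 d2 (T1 : measurableType d1)
    (T2 : measurableType d2) (X : T -> T1) (Y : T -> T2) : Prop :=
  forall (A : set T1) (B : set T2), measurable A -> measurable B ->
    P (X @^-1` A `&` Y @^-1` B) = (P (X @^-1` A) * P (Y @^-1` B))%E.

(* L^oo is handled through representatives X \in Lfun P +oo; rdeu and entropic
   below depend only on the law of X, hence only on its class. *)

Definition translation_invariant (rho : (T -> R) -> R) : Prop :=
  forall (X : T -> R) (m : R), X \in Lfun P +oo%E ->
    rho (fun w => X w + m) = rho X + m.

Definition additive_consistent (rho : (T -> R) -> R) : Prop :=
  forall X Y Z : T -> R,
    X \in Lfun P +oo%E -> Y \in Lfun P +oo%E -> Z \in Lfun P +oo%E ->
    independent_rv Z (fun w => (X w, Y w)) ->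
    rho X <= rho Y ->
    rho (fun w => X w + Z w) <= rho (fun w => Y w + Z w).

(* The inverse 'pinv_ is the true inverse of c on its range, which contains the
   argument for every essentially bounded X; its default value off the range of
   c is never used. *)
Definition rdeu (c h : R -> R) (X : T -> R) : R :=
  let S x := fine (P [set w | x < c (X w)]) in
  'pinv_(fun=> 0) setT c
    (\int[lebesgue_measure]_(x in `]-oo, 0[) (h (S x) - 1) +
     \int[lebesgue_measure]_(x in `]0, +oo[) h (S x)).

Definition entropic (beta : R) (X : T -> R) : R :=
  if beta == 0 then fine 'E_P[X]
  else beta^-1 * ln (fine 'E_P[fun w => expR (beta * X w)]).

End probability_space.

Section utility_distortion.
Context (R : realType).
Implicit Types c h : R -> R.

Definition utility c : Prop := {homo c : x y / x < y} /\ continuous c.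

(* h is a function on [0, 1]; its values elsewhere are irrelevant. *)
Definition distortion h : Prop :=
  [/\ forall x, x \in `[0, 1] -> h x \in `[0, 1],
      {within `[0, 1], continuous h},
      {in `[0, 1] &, {homo h : x y / x <= y}},
      h 0 = 0 & h 1 = 1].

Definition affine_or_exponential c : Prop :=
  exists a b : R, 0 < a /\
    ((forall x, c x = a * x + b) \/
     exists2 beta : R, beta != 0 &
       forall x, c x = a * ((expR (beta * x) - 1) / beta) + b).

End utility_distortion.

(* Main.v *)
Require Import Defs.
From HB Require Import structures.
From mathcomp Require Import all_boot all_order all_algebra.
From mathcomp Require Import all_classical all_reals all_analysis.
From mathcomp Require Import measurable_realfun ess_sup_inf.
From mathcomp Require Import ring lra.

Set Implicit Arguments.
Unset Strict Implicit.
Unset Printing Implicit Defensive.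

Import Order.TTheory GRing.Theory Num.Theory.
Import numFieldNormedType.Exports.

Local Open Scope classical_set_scope.
Local Open Scope ring_scope.

(* Write c (rho X) as the Choquet integral of c (X) with respect to h o P, which
   commutes with positive affine maps; this gives the "if" part of (i).
   Conversely, since h takes all values in [0, 1], every z between x and y is
   rho X for some X with values x and y; translation invariance then says that
   c (z + m) divides [c (x + m), c (y + m)] in the same ratio as c z divides
   [c x, c y], so every translate of c is an affine function of c, which forces
   c to be affine or exponential.
   For (ii), comparing X with the constant rho X shows that an additive
   consistent rho is translation invariant and additive on independent
   variables.  Evaluating additivity on independent X in {0, s} and Z in {0, 1}
   and eliminating s gives the Hosszu equation
     h (p q) + h (p + q - p q) = h p + h q,
   whose only continuous solution with h 0 = 0 and h 1 = 1 is the identity.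
   Standardness is used to get, from an atomless law on the real line, events of
   every probability. *)

(** * Functional equations for the utility and for the distortion *)

Section functional_equations.
Context {R : realType}.
Implicit Types (c d f h : R -> R) (a b k m p q x y z : R).

(** The difference [g] between [f] and its linear candidate is additive and vanishes on integers, so
    its values on [[0, 1]] bound it everywhere. A nonzero value would have unbounded multiples. *)
Lemma additive_nondecreasing_linear f :
  {morph f : x y / x + y} -> {homo f : x y / x <= y} ->
  forall x, f x = f 1 * x.
Proof.
move=> fD fle.
have f0 : f 0 = 0 by apply: (addrI (f 0)); rewrite -fD !addr0.
pose g x := f x - f 1 * x.
have gD x y : g (x + y) = g x + g y by rewrite /g fD; ring.
have g0 : g 0 = 0 by rewrite /g f0 mulr0 subr0.
have gN x : g (- x) = - g x.
  by apply: (addrI (g x)); rewrite -gD !subrr.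
have gMn x n : g (x *+ n) = g x *+ n.
  by elim: n => [|n IH]; rewrite ?mulr0n// !mulrS gD IH.
have gZ (i : int) : g i%:~R = 0.
  case: i => n; first by rewrite -pmulrn gMn /g mulr1 subrr mul0rn.
  by rewrite NegzE intrN gN -pmulrn gMn /g mulr1 subrr mul0rn oppr0.
have gle x : 0 <= x <= 1 -> `|g x| <= f 1.
  move=> /andP[x0 x1]; have := fle _ _ x0; have := fle _ _ x1;
    rewrite f0 => fx1 fx0.
  rewrite ler_norml /g; apply/andP; split; nra.
have gb x : `|g x| <= f 1.
  rewrite -(subrK (Num.floor x)%:~R x) gD gZ addr0; apply: gle.
  by have := floor_itv x; rewrite intrD => /andP[? ?]; apply/andP; split; lra.
move=> x; apply/eqP; rewrite -subr_eq0 -normr_eq0 -/(g x).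
apply/negPn/negP => gx0.
have gx : 0 < `|g x| by rewrite lt_neqAle eq_sym gx0 /=.
have := gb (x *+ (Num.bound (f 1 / `|g x|))).
rewrite gMn normrMn leNgt => /negP; apply.
rewrite -mulr_natr mulrC -ltr_pdivrMr// archi_boundP// divr_ge0//.
exact: le_trans (gb x).
Qed.

(** Normalised to vanish at 0 with slope 1 there, so that the identity is the limit as [beta] tends
    to 0 and one formula covers both shapes in [affine_or_exponential]. *)
Definition expo (beta x : R) : R :=
  if beta == 0 then x else (expR (beta * x) - 1) / beta.

Lemma affine_or_exponentialP c :
  affine_or_exponential c <->
  exists beta a b, 0 < a /\ forall x, c x = a * expo beta x + b.
Proof.
split.
- move=> [a [b [a0 [cE|[beta beta0 cE]]]]].
  + by exists 0, a, b; split => // x; rewrite /expo eqxx.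
  + by exists beta, a, b; split => // x; rewrite /expo (negbTE beta0).
- move=> [beta [a [b [a0 cE]]]]; exists a, b; split => //.
  have [b0|b0] := eqVneq beta 0; [left|right; exists beta => //] => x.
  + by rewrite cE /expo b0 eqxx.
  + by rewrite cE /expo (negbTE b0).
Qed.

(** For [beta != 0], this is the multiplicativity of [1 + beta * expo beta x = expR (beta * x)]. It
    makes a translation of the argument act on values by an affine map. *)
Lemma expoD beta x y :
  expo beta (x + y) = expo beta x + expo beta y + beta * (expo beta x * expo
    beta y).
Proof.
rewrite /expo; case: ifPn => [/eqP ->|b0]; first by ring.
by rewrite mulrDr expRD; field.
Qed.

Lemma expo0 beta : expo beta 0 = 0.
Proof. by rewrite /expo; case: ifP => // _;
  rewrite mulr0 expR0 subrr mul0r. Qed.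

Lemma expo_factor_gt0 beta x : 0 < 1 + beta * expo beta x.
Proof.
rewrite /expo; case: ifPn => [/eqP ->|b0]; first by rewrite mul0r addr0.
by rewrite mulrC divfK// addrC subrK expR_gt0.
Qed.

Lemma expo_lt beta x y : x < y -> expo beta x < expo beta y.
Proof.
rewrite /expo; case: ifPn => // b0 xy.
have [b1|b1|b1] := ltgtP beta 0; last by rewrite b1 eqxx in b0.
- by rewrite ltr_nM2r ?invr_lt0// ltrD2r ltr_expR ltr_nM2l.
- by rewrite ltr_pM2r ?invr_gt0// ltrD2r ltr_expR ltr_pM2l.
Qed.

Lemma continuous_expo beta : continuous (expo beta).
Proof.
rewrite /expo; have [_|_] := eqVneq beta 0; move=> x; first exact: cvg_id.
apply: cvgMl; apply: cvgB; last exact: cvg_cst.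
by apply: continuous_comp; [exact: mulrl_continuous|exact: continuous_expR].
Qed.

Lemma utility_expo beta : utility (expo beta).
Proof. by split; [exact: expo_lt | exact: continuous_expo]. Qed.

(* The quotient (c z - c x) / (c y - c x) is the weight on y of the c-mean of
   x and y that equals z, so the hypothesis says that the quasi-arithmetic means
   generated by c and by its translates c (_ + m) coincide. *)
Lemma translative_means_exponential c : {homo c : x y / x < y} ->
  (forall x y z m, x < z -> z < y ->
    (c (z + m) - c (x + m)) * (c y - c x) =
    (c z - c x) * (c (y + m) - c (x + m))) ->
  affine_or_exponential c.
Proof.
move=> clt cross; apply/affine_or_exponentialP.
have cle : {homo c : x y / x <= y} by exact: ltW_homo.
pose d x := c x - c 0.
have d0 : d 0 = 0 by rewrite /d subrr.
have d1 : 0 < d 1 by rewrite subr_gt0 clt.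
(* [A m] is the slope of the translate of [c] by [m] as an affine function of [c], read off at the
   points 0 and 1. *)
pose A m := (c (1 + m) - c m) / d 1.
have A0 m : 0 < A m by rewrite divr_gt0// subr_gt0 clt// -{1}(add0r m) ltrD2r.
have dA m z : d (z + m) = d m + A m * d z.
  suff E : (c (z + m) - c m) * (c 1 - c 0) = (c z - c 0) * (c (1 + m) - c m).
    have AE : A m * d 1 = c (1 + m) - c m by rewrite divfK// lt0r_neq0.
    apply: (mulIf (lt0r_neq0 d1)); move: E; rewrite -AE /d; lra.
  (* The hypothesis is applied to 0, 1 and [z] in increasing order, which depends on the position of
     [z]. *)
  have [z0|z0|->] := ltgtP z 0; last by rewrite !add0r; ring.
  - by have := cross _ _ _ m z0 ltr01; rewrite !add0r; nra.
  - have [z1|z1|->] := ltgtP z 1; last by ring.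
    + by have := cross _ _ _ m z0 z1; rewrite !add0r; nra.
    + by have := cross _ _ _ m ltr01 z1; rewrite !add0r; nra.
have A00 : A 0 = 1 by rewrite /A addr0 divff// lt0r_neq0.
have [A1|] := pselect (forall m, A m = 1).
  exists 0, (d 1), (c 0); split => // x; rewrite /expo eqxx.
  rewrite -additive_nondecreasing_linear ?subrK//.
  - by move=> y z; rewrite dA A1 mul1r addrC.
  - by move=> y z yz; rewrite lerD2r cle.
move=> /existsNP[m0 /eqP Am0].
have dm0 : d m0 != 0.
  have [m00|m00|m00] := ltgtP m0 0.
  - by rewrite subr_eq0 lt_eqF// clt.
  - by rewrite subr_eq0 gt_eqF// clt.
  - by rewrite m00 A00 eqxx in Am0.
pose k := (A m0 - 1) / d m0.
have k0 : k != 0 by rewrite mulf_neq0 ?invr_eq0// subr_eq0.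
(* Expanding [d (z + m0)] in both orders gives [(A z - 1) * d m0 = (A m0 - 1) * d z]. *)
have AE z : A z = 1 + k * d z.
  have := dA m0 z; rewrite addrC dA => E.
  apply: (mulIf dm0); rewrite mulrDl mul1r [k * d z * _]mulrAC.
  have -> : k * d m0 = A m0 - 1 by rewrite divfK.
  by move: E; lra.
have AM y z : A (y + z) = A y * A z by rewrite !AE dA AE; ring.
(* [A] is multiplicative, hence [f] additive; dividing by [k] makes [f] nondecreasing whatever the
   sign of [k]. *)
pose f x := ln (A x) / k.
have fE x : f x = f 1 * x.
  apply: additive_nondecreasing_linear => [y z|y z yz].
    by rewrite /f AM lnM ?posrE// mulrDl.
  have dyz : d y <= d z by rewrite lerD2r cle.
  have [k1|k1|k1] := ltgtP k 0; last by rewrite k1 eqxx in k0.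
  - rewrite ler_nM2r ?invr_lt0// ler_ln ?posrE// !AE lerD2l.
    by rewrite ler_nM2l.
  - rewrite ler_pM2r ?invr_gt0// ler_ln ?posrE// !AE lerD2l.
    by rewrite ler_pM2l.
have lnAE x : A x = expR (k * f 1 * x).
  by rewrite -mulrA -fE /f mulrC divfK// lnK// posrE.
have f10 : 0 < f 1.
  have A1 := AE 1; have [k1|k1|k1] := ltgtP k 0; last by rewrite k1 eqxx in k0.
  - rewrite nmulr_lgt0 ?invr_lt0// ln_lt0// A0/= A1.
    by rewrite gtrDl nmulr_rlt0.
  - by rewrite divr_gt0// ln_gt0// A1 ltrDl mulr_gt0.
(* Solve [1 + k * d x = expR (k * f 1 * x)] for [d x]. *)
exists (k * f 1), (f 1), (c 0); split => // x.
rewrite /expo mulf_eq0 (negbTE k0) (gt_eqF f10)/= -lnAE AE /d.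
have f1n0 := lt0r_neq0 f10.
by field; rewrite k0 f1n0.
Qed.

(** The equation is reduced to additivity of [h] on sums not exceeding 1. This determines [h] at
    rational points, and monotonicity squeezes the other values. *)
Lemma hosszu_identity h : distortion h ->
  (forall p q, 0 < p < 1 -> 0 < q < 1 ->
    h (p * q) + h (p + q - p * q) = h p + h q) ->
  {in `[0, 1], h =1 id}.
Proof.
move=> [h01 hcont hle h0 h1] hosz.
(* When [p] or [q] is 0 or 1, the two sides consist of the same two terms. *)
have {}hosz p q : 0 <= p <= 1 -> 0 <= q <= 1 ->
    h (p * q) + h (p + q - p * q) = h p + h q.
  have [->|p0] := eqVneq p 0; first by rewrite mul0r add0r subr0.
  have [->|q0] := eqVneq q 0; first by rewrite mulr0 addr0 subr0 addrC.
  have [->|p1] := eqVneq p 1.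
    by move=> _ _; rewrite mul1r addrK addrC.
  have [->|q1] := eqVneq q 1.
    by move=> _ _; rewrite mulr1 addrAC subrr add0r.
  move=> /andP[? ?] /andP[? ?]; apply: hosz; lra.
(* Iterating (x, y) |-> (x * y, x + y - x * y) preserves the sum and drives the
   first coordinate to 0. *)
have hD x y : 0 <= x -> 0 <= y -> x + y <= 1 -> h (x + y) = h x + h y.
  move=> x0 y0; have [s sE] : exists s, s = x + y by exists (x + y).
  rewrite -sE => s1.
  pose u := fix u n := if n is n'.+1 then u n' * (s - u n') else x.
  have uP n : [/\ 0 <= u n, u n <= s, u n <= n.+1%:R^-1 &
                 h (u n) + h (s - u n) = h x + h y].
    elim: n => [|n [u0 us un IH]].
      by rewrite /= invr1; split => //; [lra|lra|congr (_ + h _); lra].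
    have n0 : 0 < n.+1%:R :> R by [].
    have n1 : n.+2%:R = n.+1%:R + 1 :> R by rewrite -[n.+2]addn1 natrD.
    split => /=; [nra|nra| |].
      (* With [t = u n] and [(n + 1) * t <= 1], one has [(n + 2) * t * (1 - t) <= (1 + t) * (1 - t)
         <= 1]. *)
      have us1 : u n * (s - u n) <= u n * (1 - u n) by nra.
      apply: (le_trans us1); rewrite n1.
      have nu : n.+1%:R * u n <= 1 by rewrite mulrC -ler_pdivlMr// mul1r.
      rewrite -(mul1r (_ + 1)^-1) ler_pdivlMr; [nra|lra].
    rewrite -IH -(hosz (u n) (s - u n)); [|lra|lra].
    by congr (_ + h _); ring.
  have ucvg : u n @[n --> \oo] --> (0 : R).
    apply: (squeeze_cvgr _ (cvg_cst 0)) (@cvg_harmonic R).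
    by apply: nearW => n; have [u0 _ un _] := uP n; rewrite u0 un.
  have s0 : 0 <= s by rewrite sE addr_ge0.
  have hcvg (v : nat -> R) l : (forall n, 0 <= v n <= 1) ->
    v n @[n --> \oo] --> l ->
      h (v n) @[n --> \oo] --> h l.
    move=> v01 vl.
    have l01 : l \in `[0, 1].
      rewrite in_itv/=; apply/andP; split.
      - by apply: (cvgr_to_ge vl); apply: nearW => n; have /andP[] := v01 n.
      - by apply: (cvgr_to_le vl); apply: nearW => n; have /andP[] := v01 n.
    have /subspace_continuousP/(_ l l01) hl := hcont.
    apply: cvg_trans hl => P' /= [e e0 eP].
    have := vl; move/cvgrPdist_lt => /(_ e e0); apply: filterS => n lv.
    by apply: eP => //=; rewrite in_itv/= v01.
  have H0 : h (u n) + h (s - u n) @[n --> \oo] --> h 0 + h s.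
    apply: cvgD; apply: hcvg => //.
    - by move=> n; have [u0 us _ _] := uP n; rewrite u0 (le_trans us).
    - by move=> n; have [u0 us _ _] := uP n; apply/andP; split; lra.
    - by rewrite -[X in _ --> X]subr0; apply: cvgB => //; exact: cvg_cst.
  have E : (fun n => h (u n) + h (s - u n)) = fun=> h x + h y.
    by apply/funext => n; have [] := uP n.
  move: H0; rewrite E h0 add0r => /(cvg_unique (@norm_hausdorff _ _)) H0.
  by apply: H0; exact: cvg_cst.
have hq (n k : nat) : (k <= n.+1)%N -> h (k%:R / n.+1%:R) = k%:R * h n.+1%:R^-1.
  elim: k => [|k IH] kn; first by rewrite !mul0r.
  rewrite -addn1 natrD mulrDl mul1r hD ?IH ?mulrDl ?mul1r//; [exact: ltnW|].
  by rewrite -[X in _ + X]mul1r -mulrDl ler_pdivrMr// mul1r -[X in _ +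
    X]/(1%:R) -natrD ler_nat addn1.
have hn n : h n.+1%:R^-1 = n.+1%:R^-1.
  have := hq n n.+1 (leqnn _); rewrite divff ?pnatr_eq0// h1 => /(congr1 ( *%R
    n.+1%:R^-1)).
  by rewrite mulr1 mulKf ?pnatr_eq0.
suff hid x : 0 <= x -> x <= 1 -> h x = x.
  by move=> x; rewrite in_itv/= => /andP[x0 x1]; exact: hid.
move=> x0 x1.
have [->//|x1'] := eqVneq x 1; rewrite /=.
have {x1'}x1 : x < 1 by rewrite lt_neqAle x1'.
(* [x] and [h x] lie in the same cell of the grid of mesh [n.+1%:R^-1]; [x < 1] keeps the right end
   of that cell within [[0, 1]]. *)
have hx n : `|h x - x| <= n.+1%:R^-1.
  have n0 : 0 < n.+1%:R :> R by [].
  pose k := Num.trunc (x * n.+1%:R).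
  have /andP[k1 k2] : k%:R <= x * n.+1%:R < k.+1%:R.
    by apply: truncn_itv; rewrite mulr_ge0.
  have kn : (k < n.+1)%N.
    by rewrite -(ltr_nat R) (le_lt_trans k1)// gtr_pMl.
  have a1 : h (k%:R / n.+1%:R) <= h x.
    apply: hle; rewrite ?in_itv/= ?ler_pdivrMr//; last by rewrite x0 ltW.
    by rewrite divr_ge0//= mul1r ler_nat ltnW.
  have a2 : h x <= h (k.+1%:R / n.+1%:R).
    apply: hle; rewrite ?in_itv/=.
    - by rewrite x0 ltW.
    - by rewrite divr_ge0//= ler_pdivrMr// mul1r ler_nat.
    - by rewrite ler_pdivlMr// ltW.
  move: a1 a2; rewrite !hq// ?hn; last exact: ltnW.
  move: k1 k2; rewrite -ler_pdivrMr// -ltr_pdivlMr// -[k.+1]addn1 natrD mulrDl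
    mul1r.
  move: (k%:R / n.+1%:R : R) (n.+1%:R^-1 : R) (h x) => r s t.
  by move=> *; rewrite ler_norml; apply/andP; split; lra.
apply/eqP; rewrite -subr_eq0 -normr_le0.
apply: (cvgr_to_ge (@cvg_harmonic R)); exact: nearW.
Qed.

End functional_equations.

(** * Integrals over bounded intervals of functions with values in [[0, 1]] *)

Section unit_interval_integrals.
Context {R : realType}.
Implicit Types (g : R -> R) (a b k x : R).
Notation leb := (@lebesgue_measure R).

Lemma integrable_unit_itv g a b : measurable_fun setT g ->
  (forall x, 0 <= g x <= 1) -> leb.-integrable `[a, b] (EFin \o g).
Proof.
move=> mg g01; apply: measurable_bounded_integrable => //.
- by rewrite /= lebesgue_measure_itv/=; case: ifP; rewrite // ltry.
- exact: measurable_funTS.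
- exists 1; split; first exact: num_real.
  move=> M M1 x _ /=; have /andP[g0 g1] := g01 x.
  by rewrite ger0_norm// (le_trans g1)// ltW.
Qed.

Lemma Rintegral_itv_chasles g a x b : measurable_fun setT g ->
  (forall x, 0 <= g x <= 1) -> a <= x -> x <= b ->
  \int[leb]_(t in `[a, b]) g t =
  \int[leb]_(t in `[a, x]) g t + \int[leb]_(t in `[x, b]) g t.
Proof.
move=> mg g01 ax xb.
have gint := integrable_unit_itv a b mg g01.
rewrite -(@Rintegral_itv_obnd_cbnd _ x); last first.
  apply: integrableS gint => //.
  by move=> t /=; rewrite !in_itv/= => /andP[xt ->];
    rewrite (le_trans ax)// ltW.
have ax' : (BLeft a <= BRight x)%O by rewrite bnd_simp.
have xb' : (BRight x <= BRight b)%O by rewrite bnd_simp.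
have := Rintegral_itvB gint ax' xb'; move=> <-.
by rewrite addrC subrK.
Qed.

(** The value at [b] is left free because a tail function jumps at the right end of each of its
    steps, and a point has measure zero. *)
Lemma Rintegral_itv_const g a b k : measurable_fun setT g ->
  (forall x, 0 <= g x <= 1) -> a <= b -> (forall x, a <= x < b -> g x = k) ->
  \int[leb]_(t in `[a, b]) g t = k * (b - a).
Proof.
move=> mg g01 ab gk.
rewrite -Rintegral_itv_bndo_bndc; last first.
  apply: integrableS (integrable_unit_itv a b mg g01) => //.
  by move=> t /=; rewrite !in_itv/= => /andP[-> /ltW].
rewrite (@eq_Rintegral _ _ _ _ _ (fun=> k)); last first.
  by move=> t; rewrite inE/= in_itv/= => /gk.
rewrite Rintegral_cst//= lebesgue_measure_itv/= lte_fin.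
by move: ab; rewrite le_eqVlt => /predU1P[->|->]; rewrite ?ltxx// subrr.
Qed.

Lemma Rintegral_itv_bounds g a b : measurable_fun setT g ->
  (forall x, 0 <= g x <= 1) -> a <= b ->
  0 <= \int[leb]_(t in `[a, b]) g t <= b - a.
Proof.
move=> mg g01 ab; apply/andP; split.
  by apply: Rintegral_ge0 => x _; have /andP[] := g01 x.
have m1 : measurable_fun setT (fun _ : R => 1 : R) by exact: measurable_cst.
have i1 : leb.-integrable `[a, b] (EFin \o (fun _ : R => 1 : R)).
  by apply: integrable_unit_itv => // x; rewrite ler01 lexx.
have -> : b - a = \int[leb]_(t in `[a, b]) 1.
  by rewrite (@Rintegral_itv_const _ _ _ 1) ?mul1r// => x; rewrite ler01 lexx.
apply: le_Rintegral => //; first exact: integrable_unit_itv.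
by move=> x _; have /andP[] := g01 x.
Qed.

(** Change of variables: [k] times the image of Lebesgue measure under [x |-> k * x + m] agrees with
    Lebesgue measure on half-open intervals, hence everywhere. *)
Lemma Rintegral_itv_affine g a b (k m : R) : measurable_fun setT g ->
  (forall x, 0 <= g x <= 1) -> 0 < k -> a <= b ->
  \int[leb]_(t in `[k * a + m, k * b + m]) g ((t - m) / k) =
  k * \int[leb]_(t in `[a, b]) g t.
Proof.
move=> mg g01 k0 ab.
pose phi0 : measurableTypeR R -> measurableTypeR R := fun x => k * x + m.
have mphi : measurable_fun setT phi0.
  by apply: measurable_funD => //; exact: measurable_funM.
pose phi : {mfun measurableTypeR R >-> measurableTypeR R} :=
  HB.pack phi0 (isMeasurableFun.Build _ _ _ _ _ mphi).
pose kn := NngNum (ltW k0).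
have kleb A : measurable A -> leb A = mscale kn (pushforward leb phi) A.
  move=> mA; apply: lebesgue_measure_unique => // _ [[u v] _ <-].
  rewrite /= /mscale /= /pushforward.
  have -> : phi @^-1` `]u, v] = `](u - m) / k, (v - m) / k]%classic.
    apply/seteqP; split => x; rewrite /= !in_itv/= ltr_pdivrMr// ler_pdivlMr//;
      by rewrite ltrBlDr lerBrDr mulrC.
  rewrite !lebesgue_measure_itv/= !lte_fin ltr_pM2r ?invr_gt0// ltrD2r.
  case: ifP => _; last by rewrite mule0.
  by rewrite -!EFinD -EFinM; congr EFin; field; rewrite gt_eqF.
have mg' : measurable_fun setT (fun t : R => g ((t - m) / k)).
  apply: measurableT_comp => //.
  by apply: measurable_funM => //; exact: measurable_funB.
rewrite /Rintegral (eq_measure_integral (mscale kn (pushforward leb phi)));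
  last first.
  by move=> A mA _; exact: kleb.
have g0 x : (0 <= (g x)%:E)%E by rewrite lee_fin; have /andP[] := g01 x.
rewrite ge0_integral_mscale//; last exact/measurable_EFinP/measurable_funTS.
rewrite ge0_integral_pushforward//; last first.
  exact/measurable_EFinP/measurable_funTS.
have -> : phi @^-1` `[k * a + m, k * b + m] = `[a, b]%classic.
  by apply/seteqP; split => x; rewrite /= !in_itv/= /phi !lerD2r !ler_pM2l.
transitivity (fine (k%:E * \int[leb]_(x in `[a, b]) (g x)%:E)%E).
  congr (fine (_ * _)); apply: eq_integral => x _ /=.
  by rewrite /phi0 addrK mulrC mulKf// gt_eqF.
rewrite fineM//; apply: integrable_fin_num => //; exact: integrable_unit_itv.
Qed.

End unit_interval_integrals.

(** * The Choquet integral with respect to a distorted probability *)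

Section choquet.
Context d (T : measurableType d) (R : realType) (P : probability T R).
Implicit Types (h : R -> R) (X Y : T -> R) (a b k m x y : R).
Notation leb := (@lebesgue_measure R).

Definition tail Y x : R := fine (P [set w | x < Y w]).

(** Written so that [rdeu P c h X] is, by conversion, the inverse of [c] applied to
    [choquet P h (c \o X)]. *)
Definition choquet h Y : R :=
  \int[leb]_(x in `]-oo, 0[) (h (tail Y x) - 1) +
  \int[leb]_(x in `]0, +oo[) h (tail Y x).

Definition ae_within a b Y := \forall w \ae P, a <= Y w <= b.

Lemma measurable_tail_set Y : measurable_fun setT Y ->
  forall x, measurable [set w | x < Y w].
Proof.
move=> mY x; rewrite -[X in measurable X]setTI.
have -> : [set w | x < Y w] = Y @^-1` `]x, +oo[.
  by apply/seteqP; split => w /=; rewrite in_itv/= andbT.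
exact: mY.
Qed.

Lemma ae_probability1 (A : set T) : measurable A -> (\forall w \ae P, A w) ->
  P A = 1%E.
Proof.
move=> mA [N [mN PN AN]].
have E : (1 - P A = 0)%E.
  by rewrite -probability_setC//; apply: subset_measure0 PN => //;
    exact: measurableC.
have : (1 - P A + P A = P A)%E by rewrite E add0e.
by rewrite subeK ?fin_num_measure.
Qed.

Lemma tail01 Y x : measurable_fun setT Y -> 0 <= tail Y x <= 1.
Proof.
move=> mY; rewrite /tail fine_ge0//= -lee_fin fineK.
  by rewrite probability_le1//; exact: measurable_tail_set.
by rewrite fin_num_measure//; exact: measurable_tail_set.
Qed.

Lemma tail_le Y x y : measurable_fun setT Y -> x <= y -> tail Y y <= tail Y x.
Proof.
move=> mY xy; have mt := measurable_tail_set mY.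
rewrite /tail fine_le ?fin_num_measure// le_measure ?inE// => w /=.
exact: le_lt_trans.
Qed.

Lemma tail_lo Y a b x : measurable_fun setT Y -> ae_within a b Y -> x < a ->
  tail Y x = 1.
Proof.
move=> mY Yab xa; rewrite /tail ae_probability1//;
  first exact: measurable_tail_set.
by apply: filterS Yab => w /andP[aY _]; exact: lt_le_trans aY.
Qed.

Lemma tail_hi Y a b x : measurable_fun setT Y -> ae_within a b Y -> b <= x ->
  tail Y x = 0.
Proof.
move=> mY Yab bx; rewrite /tail.
have mx := measurable_tail_set mY x.
suff -> : P [set w | x < Y w] = 0%E by [].
rewrite -[X in P X]setCK probability_setC; last exact: measurableC.
rewrite ae_probability1 ?subee//; first exact: measurableC.
by apply: filterS Yab => w /andP[_ Yb]; apply/negP;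
  rewrite -leNgt (le_trans Yb).
Qed.

Lemma measurable_distortion_tail h Y : distortion h -> measurable_fun setT Y ->
  measurable_fun setT (fun x => h (tail Y x)).
Proof.
move=> [_ _ hle _ _] mY; apply: nonincreasing_measurable => // x y xy.
by apply: hle; rewrite ?in_itv/= ?tail01//; exact: tail_le.
Qed.

Lemma distortion_tail01 h Y x : distortion h -> measurable_fun setT Y ->
  0 <= h (tail Y x) <= 1.
Proof.
by move=> [h01 _ _ _ _] mY; have := h01 (tail Y x); rewrite !in_itv/=; apply;
  exact: tail01.
Qed.

(** The tail is 1 below [a] and 0 from [b] on, so both improper integrals live on bounded intervals
    and can be glued. *)
Lemma choquetE h Y a b : distortion h -> measurable_fun setT Y ->
  a <= b -> ae_within a b Y ->
  choquet h Y = a + \int[leb]_(x in `[a, b]) h (tail Y x).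
Proof.
move=> hd mY ab Yab.
pose g x := h (tail Y x).
have mg : measurable_fun setT g by exact: measurable_distortion_tail.
have g01 x : 0 <= g x <= 1 by exact: distortion_tail01.
have [_ _ _ h0 h1] := hd.
have glo x : x < a -> g x = 1 by move=> xa; rewrite /g (tail_lo mY Yab).
have ghi x : b <= x -> g x = 0 by move=> xa; rewrite /g (tail_hi mY Yab).
(* [[- M, M]] contains 0, [a] and [b], so one integral over it can be cut either at 0 or at [a] and
   [b]. *)
pose M : R := `|a| + `|b|.
have M0 : 0 <= M by rewrite addr_ge0.
have aM : - M <= a.
  by rewrite lerNl (le_trans (ler_norm _))// normrN lerDl.
have bM : b <= M by rewrite (le_trans (ler_norm _))// lerDr.
have MM := le_trans aM (le_trans ab bM).
suff -> : choquet h Y = - M + \int[leb]_(x in `[- M, M]) g x.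
  have aM' := le_trans ab bM.
  rewrite (@Rintegral_itv_chasles _ _ (- M) a)//.
  rewrite (@Rintegral_itv_chasles _ _ a b)//.
  rewrite (@Rintegral_itv_const _ g (- M) a 1)//; last first.
    by move=> x /andP[_ ?]; exact: glo.
  rewrite (@Rintegral_itv_const _ g b M 0)//; last first.
    by move=> x /andP[? _]; exact: ghi.
  by rewrite /g; ring.
rewrite (@Rintegral_itv_chasles _ _ _ 0)// ?oppr_le0//.
rewrite /choquet addrA; congr (_ + _).
- have -> : \int[leb]_(x in `]-oo, 0[) (h (tail Y x) - 1) =
            \int[leb]_(x in `[- M, 0[) (g x - 1).
    have -> : `[- M, 0[%classic = `]-oo, 0[%classic `&` `[- M, +oo[%classic.
      by apply/seteqP; split => x /=; rewrite !in_itv/= andbT andbC => /andP.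
    rewrite Rintegral_mkcondr; apply: eq_Rintegral => x _.
    rewrite patchE; case: ifPn => //; rewrite notin_setE/= in_itv/= andbT.
    move/negP; rewrite -ltNge => xM.
    by rewrite -/(g x) glo ?subrr// (lt_le_trans xM).
  have i1 : leb.-integrable `[- M, 0[ (EFin \o g).
    apply: integrableS (integrable_unit_itv (- M) 0 mg g01) => //.
    by move=> t /=; rewrite !in_itv/= => /andP[-> /ltW].
  have i2 : leb.-integrable `[- M, 0[ (EFin \o (fun _ : R => 1 : R)).
    apply: integrableS (@integrable_unit_itv _ (fun=> 1) (- M) 0 _ _) => //.
    + by move=> t /=; rewrite !in_itv/= => /andP[-> /ltW].
    + by move=> x; rewrite ler01 lexx.
  rewrite RintegralB// Rintegral_itv_bndo_bndc// Rintegral_cst//=.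
  rewrite lebesgue_measure_itv/= lte_fin oppr_lt0 addrC; congr (_ + _).
  rewrite mul1r; move: M0; rewrite le_eqVlt => /predU1P[<-|->].
    by rewrite ltxx.
  by rewrite -EFinD/= sub0r opprK.
- have -> : \int[leb]_(x in `]0, +oo[) h (tail Y x) =
            \int[leb]_(x in `]0, M]) g x.
    have -> : `]0, M]%classic = `]0, +oo[%classic `&` `]-oo, M]%classic.
      by apply/seteqP; split => x /=; rewrite !in_itv/= andbT => /andP.
    rewrite Rintegral_mkcondr; apply: eq_Rintegral => x _.
    rewrite patchE; case: ifPn => //; rewrite notin_setE/= in_itv/=.
    move/negP; rewrite -ltNge => xM.
    by rewrite -/(g x) ghi// (le_trans bM)// ltW.
  rewrite Rintegral_itv_obnd_cbnd//.
  apply: integrableS (integrable_unit_itv 0 M mg g01) => //.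
  by move=> t /=; rewrite !in_itv/= => /andP[/ltW -> ->].
Qed.

Lemma choquet_bounds h Y a b : distortion h -> measurable_fun setT Y ->
  a <= b -> ae_within a b Y -> a <= choquet h Y <= b.
Proof.
move=> hd mY ab Yab; rewrite (choquetE hd mY ab Yab).
have /andP[I0 I1] := Rintegral_itv_bounds (measurable_distortion_tail hd mY)
  (fun x => distortion_tail01 x hd mY) ab.
by rewrite lerDl I0 -lerBrDl.
Qed.

(** The tail of [k * Y + m] at [x] is that of [Y] at [(x - m) / k]; the rest is a change of
    variables. *)
Lemma choquet_affine h Y k m a b : distortion h -> measurable_fun setT Y ->
  a <= b -> ae_within a b Y -> 0 < k ->
  choquet h (fun w => k * Y w + m) = k * choquet h Y + m.
Proof.
move=> hd mY ab Yab k0.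
have mkY : measurable_fun setT (fun w => k * Y w + m).
  by apply: measurable_funD => //; exact: measurable_funM.
rewrite (choquetE hd mY ab Yab) (@choquetE _ _ (k * a + m) (k * b + m))//.
- rewrite mulrDr -(@Rintegral_itv_affine _ _ _ _ k m)//.
  + rewrite addrAC; congr (_ + _ + _); apply: eq_Rintegral => x _.
    congr (h (fine (P _))).
    by apply/seteqP; split => w /=; rewrite ltr_pdivrMr// ltrBlDr mulrC.
  + exact: measurable_distortion_tail.
  + by move=> x; exact: distortion_tail01.
- by rewrite lerD2r ler_pM2l.
- by apply: filterS Yab => w /andP[? ?]; rewrite !lerD2r !ler_pM2l//;
  apply/andP.
Qed.

(** The tail is a staircase with three steps. Equal levels are allowed, so that variables with fewer
    values fit too. *)
Lemma choquet_step h Y (y0 y1 y2 y3 p1 p2 p3 : R) :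
  distortion h -> measurable_fun setT Y -> y0 <= y1 -> y1 <= y2 -> y2 <= y3 ->
  (forall w, y0 <= Y w <= y3) ->
  (forall x, y0 <= x < y1 -> tail Y x = p1) ->
  (forall x, y1 <= x < y2 -> tail Y x = p2) ->
  (forall x, y2 <= x < y3 -> tail Y x = p3) ->
  choquet h Y = y0 + (h p1 * (y1 - y0) + h p2 * (y2 - y1) + h p3 * (y3 - y2)).
Proof.
move=> hd mY y01 y12 y23 Yb E1 E2 E3.
have mg := measurable_distortion_tail hd mY.
have g01 x := distortion_tail01 x hd mY.
have y02 := le_trans y01 y12.
rewrite (@choquetE _ _ y0 y3)//; [|exact: le_trans y23|exact: aeW].
congr (_ + _).
rewrite (@Rintegral_itv_chasles _ _ _ y2)// (@Rintegral_itv_chasles _ _ _ y1)//.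
rewrite (@Rintegral_itv_const _ _ y0 y1 (h p1))//; last by move=> x /E1 ->.
rewrite (@Rintegral_itv_const _ _ y1 y2 (h p2))//; last by move=> x /E2 ->.
by rewrite (@Rintegral_itv_const _ _ y2 y3 (h p3))// => x /E3 ->.
Qed.

(** This is the layer-cake formula, the mean as an integral of [ccdf] over the positive half-line
    minus one of [cdf] over the negative half-line. *)
Lemma choquet_id h Y : {in `[0, 1], h =1 id} -> measurable_fun setT Y ->
  P.-integrable setT (EFin \o Y) -> choquet h Y = fine 'E_P[Y].
Proof.
move=> hid mY iY.
pose Y' : {RV P >-> R} := HB.pack Y (isMeasurableFun.Build _ _ _ _ _ mY).
have tailE x : (tail Y x)%:E = ccdf Y' x.
  rewrite fineK; last by rewrite fin_num_measure//; exact: measurable_tail_set.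
  congr (P _).
  by apply/seteqP; split => w /=; rewrite in_itv/= andbT.
have htail x : h (tail Y x) = tail Y x by rewrite hid// in_itv/= tail01.
have E : ('E_P[Y] = \int[leb]_(r in `[0%R, +oo[) ccdf Y' r -
    \int[leb]_(r in `]-oo, 0%R[) cdf Y' r)%E.
  by apply: (@expectation_cdf_ccdf _ _ _ _ Y'); exact/Lfun1_integrable.
have Efin : ('E_P[Y])%E \is a fin_num by
  exact/expectation_fin_num/Lfun1_integrable.
rewrite E fin_numB in Efin; case/andP: Efin => fin1 fin2.
rewrite E fineB// addrC /choquet /Rintegral; congr (_ + _).
- rewrite -fineN -integral_ge0N//; congr fine; apply: eq_integral => x _.
  by rewrite htail EFinB tailE ccdf_1_cdf addeAC subee// add0e.
- congr fine; rewrite -integral_itv_obnd_cbnd; last first.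
    by apply: measurable_funTS; exact: ccdf_measurable.
  by apply: eq_integral => x _; rewrite htail tailE.
Qed.

End choquet.

(** * Essentially bounded variables and the certainty equivalent *)

Section essentially_bounded.
Context d (T : measurableType d) (R : realType) (P : probability T R).
Implicit Types (X Y Z U V : T -> R) (k m M : R) (c h : R -> R).

Lemma LfunyP X : X \in Lfun P +oo%E <->
  measurable_fun setT X /\ exists2 M, 0 <= M & ae_within P (- M) M X.
Proof.
have P0 : (0 < P setT)%E by rewrite probability_setT.
split=> [|[mX [M M0 XM]]].
- rewrite inE => /andP[/[1!inE]/= mX]; rewrite inE/= /finite_norm unlock/= P0.
  move=> /ess_supr_bounded[M XM]; split => //.
  exists `|M| => //; apply: filterS XM => w XM.
  by rewrite -ler_norml (le_trans XM)// ler_norm.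
- rewrite inE; apply/andP; split; rewrite inE//=.
  rewrite /finite_norm unlock/= P0 (@le_lt_trans _ _ M%:E) ?ltry//.
  by apply/ess_supP; apply: filterS XM => w; rewrite /= lee_fin ler_norml.
Qed.

Lemma Lfuny_affine X k m : X \in Lfun P +oo%E ->
  (fun w => k * X w + m) \in Lfun P +oo%E.
Proof.
move=> /LfunyP[mX [M M0 XM]]; apply/LfunyP; split.
  by apply: measurable_funD => //; exact: measurable_funM.
exists (`|k| * M + `|m|); first by rewrite addr_ge0// mulr_ge0.
apply: filterS XM => w; rewrite -!ler_norml => XM.
by rewrite (le_trans (ler_normD _ _))// lerD2r normrM ler_wpM2l.
Qed.

Lemma LfunyD X Z : X \in Lfun P +oo%E -> Z \in Lfun P +oo%E ->
  (fun w => X w + Z w) \in Lfun P +oo%E.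
Proof.
move=> /LfunyP[mX [M M0 XM]] /LfunyP[mZ [N N0 ZN]]; apply/LfunyP; split.
  exact: measurable_funD.
exists (M + N); first by rewrite addr_ge0.
apply: filterS2 XM ZN => w; rewrite -!ler_norml => XM ZN.
by rewrite (le_trans (ler_normD _ _))// lerD.
Qed.

Lemma Lfuny_cst k : (fun=> k) \in Lfun P +oo%E.
Proof.
apply/LfunyP; split; first exact: measurable_cst.
by exists `|k| => //; apply: aeW => w; rewrite -ler_norml.
Qed.

Lemma Lfuny_expR X k : X \in Lfun P +oo%E ->
  (fun w => expR (k * X w)) \in Lfun P +oo%E.
Proof.
move=> /LfunyP[mX [M M0 XM]]; apply/LfunyP; split.
  by apply: measurableT_comp => //; exact: measurable_funM.
exists (expR (`|k| * M)); first exact: expR_ge0.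
apply: filterS XM => w; rewrite -!ler_norml => XM.
rewrite ger0_norm ?expR_ge0// ler_expR (le_trans (ler_norm _))//.
by rewrite normrM ler_wpM2l.
Qed.

Lemma Lfuny_integrable X : X \in Lfun P +oo%E ->
  P.-integrable setT (EFin \o X).
Proof.
move=> LX; apply/Lfun1_integrable; apply: (Lfun_subset _ _ _ _ LX) => //.
- by rewrite leey.
- by rewrite fin_num_measure.
- by rewrite leey.
Qed.

Lemma ae_within_utility X c M : utility c -> ae_within P (- M) M X ->
  ae_within P (c (- M)) (c M) (c \o X).
Proof.
move=> [clt _]; have cle := ltW_homo clt.
by apply: filterS => w /andP[? ?] /=; rewrite !cle.
Qed.

Lemma measurable_utility X c : utility c -> measurable_fun setT X ->
  measurable_fun setT (c \o X).
Proof.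
move=> [_ cc] mX; apply: measurableT_comp => //;
  exact: continuous_measurable_fun.
Qed.

Lemma utility_inj c : utility c -> injective c.
Proof. by move=> [clt _]; apply: inc_inj; exact: le_mono. Qed.

(** The Choquet integral lies between [c (- M)] and [c M], hence in the range of [c] by the
    intermediate value theorem, where [pinv] is a true inverse. With [utility_inj], identities about
    [rdeu] can be checked after applying [c]. *)
Lemma utility_rdeu c h X : utility c -> distortion h -> X \in Lfun P +oo%E ->
  c (rdeu P c h X) = choquet P h (c \o X).
Proof.
move=> uc hd /LfunyP[mX [M M0 XM]].
have [clt cc] := uc.
rewrite [rdeu _ _ _ _]/('pinv_(fun=> 0) setT c (choquet P h (c \o X))).
apply: pinvK; rewrite inE/=.
have MM : - M <= M by rewrite (le_trans _ M0)// oppr_le0.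
have cMM : c (- M) <= c M by exact: (ltW_homo clt).
have /andP[I1 I2] := choquet_bounds hd (measurable_utility uc mX) cMM
  (ae_within_utility uc XM).
have I12 : Num.min (c (- M)) (c M) <= choquet P h (c \o X) <=
    Num.max (c (- M)) (c M) by rewrite min_l// max_r// I1.
by have [x _ xE] := IVT MM (continuous_subspaceT cc) I12; exists x.
Qed.

Lemma rdeu_cst c h k : utility c -> distortion h -> rdeu P c h (fun=> k) = k.
Proof.
move=> uc hd; apply: (utility_inj uc); rewrite utility_rdeu ?Lfuny_cst//.
apply/eqP; rewrite eq_le andbC; apply: choquet_bounds => //.
  exact: measurable_cst.
by apply: aeW => w; rewrite /= lexx.
Qed.

Lemma fine_expectation_affine X k m : X \in Lfun P +oo%E ->
  fine 'E_P[fun w => k * X w + m] = k * fine 'E_P[X] + m.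
Proof.
move=> LX; have iX := Lfuny_integrable LX.
have LX1 : X \in Lfun P 1 by exact/Lfun1_integrable.
have LkX : k \o* X \in Lfun P 1.
  rewrite (_ : k \o* X = fun w => k * X w + 0); last first.
    by apply/funext => w /=; rewrite addr0 mulrC.
  exact/Lfun1_integrable/Lfuny_integrable/Lfuny_affine.
have Lm : cst m \in Lfun P 1 by
  exact/Lfun1_integrable/Lfuny_integrable/Lfuny_cst.
have -> : (fun w => k * X w + m) = (k \o* X) \+ cst m.
  by apply/funext => w /=; rewrite mulrC.
rewrite expectationD// expectationZl// expectation_cst.
rewrite fineD//; last by rewrite fin_numM// expectation_fin_num.
by rewrite fineM// expectation_fin_num.
Qed.

End essentially_bounded.

(** * Independent variables and expectations of products *)

Section independence.
Context d (T : measurableType d) (R : realType) (P : probability T R).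
Implicit Types (X Y Z U V : T -> R) (A B D E : set T).

Lemma independent_rv_comp d1 d2 d1' d2' (T1 : measurableType d1)
    (T2 : measurableType d2) (T1' : measurableType d1')
    (T2' : measurableType d2') (X : T -> T1) (Y : T -> T2)
    (f : T1 -> T1') (g : T2 -> T2') :
  measurable_fun setT f -> measurable_fun setT g ->
  independent_rv P X Y -> independent_rv P (f \o X) (g \o Y).
Proof.
move=> mf mg XY A B mA mB.
have mfA : measurable (f @^-1` A) by rewrite -[X in measurable X]setTI;
  exact: mf.
have mgB : measurable (g @^-1` B) by rewrite -[X in measurable X]setTI;
  exact: mg.
exact: (XY _ _ mfA mgB).
Qed.

(** By independence the joint law and the product of the laws agree on measurable rectangles, hence
    everywhere; Tonelli's theorem then separates the integral. *)
Lemma ge0_expectation_independent U V : measurable_fun setT U ->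
  measurable_fun setT V -> (forall w, 0 <= U w) -> (forall w, 0 <= V w) ->
  independent_rv P U V ->
  ('E_P[(fun w => U w * V w)%R] = 'E_P[U] * 'E_P[V])%E.
Proof.
move=> mU mV U0 V0 UV.
pose U' : {RV P >-> R} := HB.pack U (isMeasurableFun.Build _ _ _ _ _ mU).
pose V' : {RV P >-> R} := HB.pack V (isMeasurableFun.Build _ _ _ _ _ mV).
have mW : measurable_fun setT (fun w => (U w, V w)) by exact:
  measurable_fun_pair.
pose W : {RV P >-> (R * R)%type} :=
  HB.pack (fun w => (U w, V w)) (isMeasurableFun.Build _ _ _ _ _ mW).
(* The identity is truncated below at 0 because Tonelli's theorem wants an
   integrand that is nonnegative on all of R * R. *)
pose f (x : R) : \bar R := (Num.max x 0)%:E.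
have f0 x : (0 <= f x)%E by rewrite lee_fin le_max lexx orbT.
have mf : measurable_fun setT f.
  by apply/measurable_EFinP; apply: measurable_maxr.
have fE w : f (U w) = (U w)%:E by rewrite /f max_l.
have fE' w : f (V w) = (V w)%:E by rewrite /f max_l.
have EU : ('E_P[U] = \int[distribution P U']_x f x)%E.
  rewrite ge0_integral_distribution// unlock.
  by apply: eq_integral => w _ /=; rewrite fE.
have EV : ('E_P[V] = \int[distribution P V']_x f x)%E.
  rewrite ge0_integral_distribution// unlock.
  by apply: eq_integral => w _ /=; rewrite fE'.
have mff : measurable_fun setT (fun p : R * R => f p.1 * f p.2)%E.
  by apply: emeasurable_funM; apply: measurableT_comp.
have -> : ('E_P[(fun w => U w * V w)%R] = \int[distribution P W]_p (f p.1 * f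
  p.2))%E.
  rewrite ge0_integral_distribution//; last by move=> p; exact: mule_ge0.
  by rewrite unlock; apply: eq_integral => w _ /=; rewrite fE fE' EFinM.
rewrite (eq_measure_integral (distribution P U' \x distribution P V')%E);
  last first.
  move=> A mA _; apply/esym; exact: product_measure_unique.
rewrite fubini_tonelli1//=; last by move=> p; exact: mule_ge0.
rewrite /fubini_F EU EV -ge0_integralZr//; last exact: integral_ge0.
by apply: eq_integral => x _ /=; rewrite ge0_integralZl.
Qed.

Lemma independent_setC D E : measurable D -> measurable E ->
  P (D `&` E) = (P D * P E)%E -> P (D `&` ~` E) = (P D * P (~` E))%E.
Proof.
move=> mD mE DE.
have PDf : P D \is a fin_num by rewrite fin_num_measure.
have PEf : P E \is a fin_num by rewrite fin_num_measure.
rewrite -setDE measureD//; last by rewrite ltey_eq PDf.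
by rewrite [X in (_ - X)%E]DE probability_setC// muleBr// ?mule1//
  fin_num_adde_defr.
Qed.

(** A variable determined by one event pulls every set back to the empty set, the whole space, the
    event or its complement, so closure under complements suffices. *)
Lemma independent_rv_indicator d1 d2 (T1 : measurableType d1)
    (T2 : measurableType d2) A B (f : bool -> T1) (g : bool -> T2) :
  measurable A -> measurable B -> P (A `&` B) = (P A * P B)%E ->
  independent_rv P (fun w => f (w \in A)) (fun w => g (w \in B)).
Proof.
move=> mA mB AB U V mU mV.
have preE d0 (T0 : measurableType d0) (u : bool ->
  T0) (S : set T) (W : set T0) :
    measurable S ->
    let Q := (fun w => u (w \in S)) @^-1` W in
    [\/ Q = set0, Q = setT, Q = S | Q = ~` S].
  move=> mS /=.
  have [Wt|Wt] := pselect (W (u true)); have [Wf|Wf] := pselect (W (u false)).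
  - constructor 2; apply/seteqP; split => w //= _; by case: (w \in S).
  - constructor 3; apply/seteqP; split => w /=.
      by case: (boolP (w \in S)) => [/set_mem|_ /Wf].
    by move=> Sw; rewrite mem_set.
  - constructor 4; apply/seteqP; split => w /=.
      by case: (boolP (w \in S)) => [_ /Wt|/negP wS _ /mem_set].
    by move=> Sw; rewrite memNset.
  - constructor 1; apply/seteqP; split => w //=; by case: (w \in S).
have gen (D E : set T) : measurable D -> measurable E ->
  P (D `&` E) = (P D * P E)%E ->
    forall F, [\/ F = set0, F = setT, F = E | F = ~` E] ->
    measurable F /\ P (D `&` F) = (P D * P F)%E.
  move=> mD mE DE F [] ->.
  - by rewrite setI0 measure0 mule0.
  - by rewrite setIT probability_setT mule1.
  - by [].
  - by split; [exact: measurableC|exact: independent_setC].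
(* [B] is replaced by a preimage under the second variable with [A] fixed; then [A] is replaced with
   that preimage fixed. *)
have [mG AG] := gen _ _ mA mB AB _ (preE _ _ g B V mB).
rewrite setIC muleC in AG.
by have [_] := gen _ _ mG mA AG _ (preE _ _ f A U mA); rewrite setIC muleC.
Qed.

Lemma independent_rv_cst d1 d2 (T1 : measurableType d1) (T2 : measurableType d2)
    (k : T1) (Y : T -> T2) : measurable_fun setT Y ->
  independent_rv P (fun=> k) Y.
Proof.
move=> mY A B mA mB; rewrite preimage_cst; case: ifPn => _.
- by rewrite setTI probability_setT mul1e.
- by rewrite set0I measure0 mul0e.
Qed.

End independence.

(** * Independent events of prescribed probabilities *)

Section atomless_standard.
Context d (T : measurableType d) (R : realType) (P : probability T R).
Hypotheses (Pst : standard_space P) (Pat : atomless P).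

(** Off the null set [N], a fibre of the injective [f] has at most one point. It cannot contain a
    nonempty part of smaller probability, so atomlessness makes it null. *)
Lemma standard_atomless_diffuse : exists2 f : T -> R, measurable_fun setT f &
  forall t, P (f @^-1` [set t]) = 0%E.
Proof.
have [N [f [mN PN mf finj _]]] := Pst; exists f => // t.
have mft : measurable (f @^-1` [set t]).
  by rewrite -[X in measurable X]setTI; exact: mf.
pose A := f @^-1` [set t] `\` N.
have mA : measurable A by exact: measurableD.
have PA : P (f @^-1` [set t]) = P A.
  apply/eqP; rewrite eq_le andbC; apply/andP; split.
    by rewrite le_measure ?inE// => w [].
  rewrite -[leLHS](_ : P (A `|` (f @^-1` [set t] `&` N)) = _); last first.
    by rewrite /A setUC setUIDK.
  rewrite (le_trans (measureU2 _ _ _))//; first exact: measurableI.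
  have mI : measurable (f @^-1` [set t] `&` N) by exact: measurableI.
  by rewrite [X in (_ + X)%E](_ : _ = 0%E) ?adde0//; exact: subset_measure0 PN.
rewrite PA; apply/eqP; rewrite -measure_le0 leNgt; apply/negP => PA0.
have [B [mB BA PB0 PBA]] := Pat mA PA0.
have [B0|/set0P[w Bw]] := eqVneq B set0.
  by rewrite B0 measure0 ltxx in PB0.
suff AB : A `<=` B.
  by move: PBA; rewrite (_ : B = A) ?ltxx//; apply/seteqP.
have [fw Nw] := BA _ Bw.
move=> v [fv Nv]; rewrite (_ : v = w)//.
by apply: finj; rewrite ?inE// fv fw.
Qed.

(** An intermediate value argument for the distribution function of [f], which has no jumps; the
    level is the infimum of the points where it reaches [p]. *)
Lemma diffuse_sublevel (f : T -> R) : measurable_fun setT f ->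
  (forall t, P (f @^-1` [set t]) = 0%E) ->
  forall p : R, 0 < p < 1 -> exists t, P [set w | f w <= t] = p%:E.
Proof.
move=> mf fdiff p /andP[p0 p1].
have mX x : measurable [set w | f w <= x].
  rewrite -[X in measurable X]setTI.
  have -> : [set w | f w <= x] = f @^-1` `]-oo, x].
    by apply/seteqP; split => w /=; rewrite in_itv.
  exact: mf.
have mf1 x : measurable (f @^-1` [set x]).
  by rewrite -[X in measurable X]setTI; exact: mf.
pose X : {RV P >-> R} := HB.pack f (isMeasurableFun.Build _ _ _ _ _ mf).
have XE x : P [set w | f w <= x] = cdf X x.
  by congr (P _); apply/seteqP; split => w /=; rewrite in_itv.
have Xfin x : cdf X x \is a fin_num by rewrite -XE fin_num_measure.
pose F x := fine (cdf X x).
have FE x : cdf X x = (F x)%:E by rewrite fineK.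
have Fle x y : x <= y -> F x <= F y.
  by move=> xy; rewrite fine_le// cdf_nondecreasing.
have [x1 _ px1] : exists2 x1, 0 < x1 & p < F x1.
  by apply: pinfty_ex_gt => //; exact: cvgr_gt (fine_cvg (cvg_cdfy1 X)) _ p1.
have [x0 [_ px0]] := cvgr_lt _ (fine_cvg (cvg_cdfNy0 X)) _ p0.
pose S := [set x | p <= F x].
have S0 : has_inf S.
  split; first by exists x1; exact: ltW.
  by exists x0 => x /= px; rewrite leNgt; apply/negP => /px0;
    rewrite /= ltNge -/(F x) px.
exists (inf S); rewrite XE; apply/eqP; rewrite eq_le; apply/andP; split.
(* Upper bound: the fibre over [inf S] is null, and the open sublevel set is an increasing union of
   sublevel sets at points below [inf S], where [F] stays below [p]. *)
- rewrite -XE.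
  have -> : [set w | f w <= inf S] = [set w | f w < inf S] `|` f @^-1` [set inf
    S].
    apply/seteqP; split => w /=; first by rewrite le_eqVlt => /predU1P[|];
      [right|left].
    by move=> [/ltW|->].
  have Sbig : [set w | f w < inf S] = \bigcup_n [set w | f w <= inf S -
    n.+1%:R^-1].
    apply/seteqP; split => w /=.
      move=> fS; exists (Num.bound (inf S - f w)^-1) => //=.
      rewrite lerBrDl -lerBrDr invf_ple ?posrE ?subr_gt0//.
      by rewrite (le_trans (ltW (archi_boundP _)))// ?invr_ge0 ?subr_ge0
        ?ler_nat// ltW.
    by move=> [n _ /= fn]; rewrite (le_lt_trans fn)// ltrBlDr ltrDl.
  have mS : measurable [set w | f w < inf S] by rewrite Sbig;
    exact: bigcup_measurable.
  suff PS : (P [set w | (f w < inf S)%R] <= p%:E)%E.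
    have fS : (P (f @^-1` [set inf S]) <= 0)%E by rewrite fdiff.
    by rewrite (le_trans (measureU2 _ _ _))// -[leRHS]adde0; exact: leeD PS fS.
  rewrite Sbig.
  have cvgS : (P \o (fun n => [set w | f w <= inf S - n.+1%:R^-1])) n @[n -->
    \oo] -->
      P (\bigcup_n [set w | f w <= inf S - n.+1%:R^-1]).
    apply: nondecreasing_cvg_mu => //; first exact: bigcup_measurable.
    move=> n m nm; apply/subsetPset => w /= /le_trans; apply.
    by rewrite lerD2l lerN2 lef_pV2 ?posrE// ler_nat.
  apply: (cvge_to_le cvgS); apply: nearW => n /=.
  rewrite XE FE lee_fin leNgt; apply/negP => /ltW/(ge_inf S0.2).
  by rewrite leNgt ltrBlDr ltrDl invr_gt0 ltr0n.
(* Lower bound: [F] is at least [p] to the right of [inf S], and [cdf] is right-continuous. *)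
- have rc : cdf X x @[x --> (inf S)^'+] --> cdf X (inf S).
    exact: cdf_right_continuous.
  apply: (cvge_to_ge rc); near=> x.
  have Sx : 0 < x - inf S by rewrite subr_gt0.
  have [e Se] := inf_adherent Sx S0; rewrite addrC subrK => ex.
  by rewrite FE lee_fin (le_trans Se)// Fle// ltW.
Unshelve. all: by end_near. Qed.

(** Take nested sublevel sets [D1], [D2], [D3] of probabilities [p * q], [p] and [p + q - p * q].
    With [A] equal to [D2], joining [D1] to the ring between [D2] and [D3] gives [B] of probability
    [q] meeting [A] in [D1]. *)
Lemma exists_independent_events (p q : R) : 0 < p < 1 -> 0 < q < 1 ->
  exists A B, [/\ measurable A, measurable B, P A = p%:E, P B = q%:E &
    P (A `&` B) = (P A * P B)%E].
Proof.
move=> /andP[p0 p1] /andP[q0 q1].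
have [f mf fdiff] := standard_atomless_diffuse.
have lev := diffuse_sublevel mf fdiff.
have mlev t : measurable [set w | f w <= t].
  rewrite -[X in measurable X]setTI.
  have -> : [set w | f w <= t] = f @^-1` `]-oo, t].
    by apply/seteqP; split => w /=; rewrite in_itv.
  exact: mf.
(* Sublevel sets form a chain, so comparing probabilities decides inclusion. *)
have levS s t r u : P [set w | f w <= s] = r%:E ->
  P [set w | f w <= t] = u%:E ->
    r < u -> [set w | f w <= s] `<=` [set w | f w <= t].
  move=> sr tu ru w /= ws; apply: (le_trans ws); rewrite leNgt;
    apply/negP => ts.
  move: ru; rewrite ltNge -lee_fin -sr -tu => /negP; apply.
  rewrite le_measure ?inE// => v /= vt; exact: le_trans (ltW ts).
have [t1 E1] : exists t, P [set w | f w <= t] = (p * q)%:E by apply: lev; nra.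
have [t2 E2] := lev p ltac:(by rewrite p0).
have [t3 E3] : exists t, P [set w | f w <= t] = (p + q - p * q)%:E.
  by apply: lev; nra.
have S12 := levS _ _ _ _ E1 E2 ltac:(nra).
have S23 := levS _ _ _ _ E2 E3 ltac:(nra).
move: (mlev t1) (mlev t2) (mlev t3) S12 S23 E1 E2 E3.
move: [set w | f w <= t1] [set w | f w <= t2] [set w | f w <= t3] => D1 D2 D3.
move=> m1 m2 m3 S12 S23 E1 E2 E3.
have m32 : measurable (D3 `\` D2) by exact: measurableD.
exists D2, (D1 `|` D3 `\` D2).
have PB : P (D1 `|` D3 `\` D2) = q%:E.
  rewrite measureU//; last first.
    by apply/seteqP; split => w //= [/S12 ? []].
  rewrite measureD//; last by rewrite ltey_eq fin_num_measure.
  transitivity ((p * q)%:E + ((p + q - p * q)%:E - p%:E))%E.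
    by congr (_ + (_ - _))%E => //; rewrite (setIidr S23).
  by rewrite -EFinB -EFinD; congr EFin; ring.
split => //; first exact: measurableU.
rewrite PB E2 (_ : D2 `&` _ = D1) ?E1//.
apply/seteqP; split => w /=; first by move=> [? [//|[_ ?]]].
by move=> D1w; split; [exact: S12|left].
Qed.

End atomless_standard.

(** * Entropic risk measures and their additivity *)

Section entropic_measures.
Context d (T : measurableType d) (R : realType) (P : probability T R).
Implicit Types (X Y Z : T -> R) (c h : R -> R) (beta : R).

Lemma distortion_id : distortion (@id R).
Proof. by split => //; apply: continuous_subspaceT => x; exact: cvg_id. Qed.

Lemma expectation_expR_gt0 beta X : X \in Lfun P +oo%E ->
  0 < fine 'E_P[fun w => expR (beta * X w)].
Proof.
move=> LX; have LE := Lfuny_expR beta LX.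
have [mE _] := (LfunyP P _).1 LE.
have [_ [M M0 XM]] := (LfunyP P _).1 LX.
have bE : ae_within P (expR (- (`|beta| * M))) (expR (`|beta| * M))
    (fun w => expR (beta * X w)).
  apply: filterS XM => w; rewrite -ler_norml !ler_expR -ler_norml => XM.
  by rewrite normrM ler_wpM2l.
rewrite -(choquet_id (h := id))//; last exact: Lfuny_integrable.
apply: lt_le_trans (expR_gt0 (- (`|beta| * M))) _.
have EE : expR (- (`|beta| * M)) <= expR (`|beta| * M).
  by rewrite ler_expR ge0_cp// mulr_ge0.
by have /andP[] := choquet_bounds distortion_id mE EE bE.
Qed.

(** For [beta != 0], the mean of the exponential of a sum factors by independence, and [ln] turns
    the product into a sum; for [beta = 0] this is linearity of the mean. *)
Lemma entropicD beta X Z : X \in Lfun P +oo%E -> Z \in Lfun P +oo%E ->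
  independent_rv P Z X ->
  entropic P beta (fun w => X w + Z w) = entropic P beta X + entropic P beta Z.
Proof.
move=> LX LZ ZX; rewrite /entropic; case: ifPn => [_|b0].
  have LX1 : X \in Lfun P 1 by exact/Lfun1_integrable/Lfuny_integrable.
  have LZ1 : Z \in Lfun P 1 by exact/Lfun1_integrable/Lfuny_integrable.
  by rewrite [X in fine X](expectationD LX1 LZ1) fineD// expectation_fin_num.
have LEX := Lfuny_expR beta LX; have LEZ := Lfuny_expR beta LZ.
have [mEX _] := (LfunyP P _).1 LEX; have [mEZ _] := (LfunyP P _).1 LEZ.
have mb : measurable_fun setT (fun x : R => expR (beta * x)).
  by apply: measurableT_comp => //; exact: measurable_funM.
have indE : independent_rv P (fun w => expR (beta * Z w)) (fun w => expR (beta
  * X w)).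
  exact: (independent_rv_comp mb mb ZX).
rewrite -mulrDr -lnM ?posrE ?expectation_expR_gt0//.
rewrite -fineM; last 2 first.
- exact/expectation_fin_num/Lfun1_integrable/Lfuny_integrable.
- exact/expectation_fin_num/Lfun1_integrable/Lfuny_integrable.
rewrite muleC -ge0_expectation_independent//; [|move=> w; exact: expR_ge0..].
congr (_ * ln (fine (expectation P _))); apply/funext => w.
by rewrite mulrDr expRD mulrC.
Qed.

Lemma entropic_additive_consistent beta : additive_consistent P (entropic P
  beta).
Proof.
move=> X Y Z LX LY LZ indep XY.
have indepX : independent_rv P Z X.
  exact: (independent_rv_comp (f := id) (g := fst) _ _ indep).
have indepY : independent_rv P Z Y.
  exact: (independent_rv_comp (f := id) (g := snd) _ _ indep).
by rewrite !entropicD// lerD2r.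
Qed.

(** For the identity distortion the Choquet integral is the mean, so applying [c] reduces the claim
    to linearity of expectation. *)
Lemma rdeu_entropic c h beta a b : utility c -> distortion h ->
  {in `[0, 1], h =1 id} -> 0 < a -> (forall x, c x = a * expo beta x + b) ->
  forall X, X \in Lfun P +oo%E -> rdeu P c h X = entropic P beta X.
Proof.
move=> uc hd hid a0 cE X LX; apply: (utility_inj uc).
rewrite utility_rdeu//.
have [mX [M M0 XM]] := (LfunyP P _).1 LX.
(* [V] is [X] or its exponential. The slope [k] is negative when [beta < 0], which is harmless
   because the mean, unlike a general Choquet integral, commutes with every affine map. *)
have [V [k [m [LV cV]]]] : exists V k m, [/\ V \in Lfun P +oo%E,
    (forall w, c (X w) = k * V w + m) &
    c (entropic P beta X) = k * fine 'E_P[V] + m].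
  rewrite /entropic; have [b0|b0] := eqVneq beta 0.
    by exists X, a, b; rewrite !cE /expo b0 eqxx; split => // w;
      rewrite cE /expo b0 eqxx.
  have LE := Lfuny_expR beta LX.
  exists (fun w => expR (beta * X w)), (a / beta), (b - a / beta).
  split => // [w|]; rewrite cE /expo (negbTE b0); first by field.
  rewrite mulVKf// lnK ?posrE ?expectation_expR_gt0//.
  by field.
move=> ->.
have cXE : c \o X = fun w => k * V w + m by apply/funext => w; rewrite /= cV.
rewrite cXE choquet_id ?fine_expectation_affine//.
- by have [] := (LfunyP P _).1 (Lfuny_affine k m LV).
- exact/Lfuny_integrable/Lfuny_affine.
Qed.

End entropic_measures.

(** * Choquet integrals of variables generated by one or two events *)

Section two_point_variables.
Context d (T : measurableType d) (R : realType) (P : probability T R).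
Implicit Types (X Y Z : T -> R) (A B : set T) (c h : R -> R).

Lemma measurable_indic_comb A B (u : bool -> bool -> R) :
  measurable A -> measurable B ->
  measurable_fun setT (fun w => u (w \in A) (w \in B)).
Proof.
move=> mA mB.
(* The polynomial in the two indicators that interpolates the four values of [u]. *)
rewrite (_ : (fun _ => _) = fun w =>
   u false false + (u true false - u false false) * \1_A w +
   (u false true - u false false) * \1_B w +
   (u true true - u true false - u false true + u false false) * (\1_A w * \1_B
     w)).
  repeat apply: measurable_funD => //;
    repeat apply: measurable_funM => //; exact: measurable_indic.
by apply/funext => w; rewrite !indicE; case: (w \in A); case: (w \in B) => /=;
  ring.
Qed.

(** The outcomes are ranked as neither event, [B] alone, [A] alone, both; the upper level sets are
    thus the union, then [A], then the intersection. *)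
Lemma choquet_two_events h A B (u : bool -> bool -> R) (p q r : R) :
  distortion h -> measurable A -> measurable B ->
  P (A `|` B) = p%:E -> P A = q%:E -> P (A `&` B) = r%:E ->
  u false false <= u false true -> u false true <= u true false ->
  u true false <= u true true ->
  choquet P h (fun w => u (w \in A) (w \in B)) =
  u false false + (h p * (u false true - u false false) +
    h q * (u true false - u false true) + h r * (u true true - u true false)).
Proof.
move=> hd mA mB pE qE rE u01 u12 u23.
apply: choquet_step => //.
- exact: measurable_indic_comb.
- have u02 := le_trans u01 u12; have u13 := le_trans u12 u23.
  have u03 := le_trans u01 u13.
  by move=> w; case: (w \in A); case: (w \in B);
    rewrite ?lexx ?u01 ?u02 ?u03 ?u13 ?u23.
- move=> x /andP[x0 x1]; rewrite /tail (_ : [set w | _] = A `|` B) ?pE//.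
  apply/seteqP; split => w /=.
    case: (boolP (w \in A)) => [/set_mem|wA]; first by left.
    case: (boolP (w \in B)) => [/set_mem|wB]; first by right.
    by rewrite ltNge x0.
  move=> [/mem_set ->|/mem_set ->].
    by case: (w \in B); rewrite (lt_le_trans x1)// (le_trans u12).
  by case: (w \in A); rewrite (lt_le_trans x1)// (le_trans u12).
- move=> x /andP[x0 x1]; rewrite /tail (_ : [set w | _] = A) ?qE//.
  apply/seteqP; split => w /=.
    case: (boolP (w \in A)) => [/set_mem//|wA].
    by case: (w \in B); rewrite ltNge ?x0// (le_trans u01).
  by move=> /mem_set ->; case: (w \in B); rewrite (lt_le_trans x1).
- move=> x /andP[x0 x1]; rewrite /tail (_ : [set w | _] = A `&` B) ?rE//.
  apply/seteqP; split => w /=.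
    case: (boolP (w \in A)) => [/set_mem wA|wA].
      by case: (boolP (w \in B)) => [/set_mem//|wB]; rewrite ltNge x0.
    by case: (w \in B); rewrite ltNge ?(le_trans u12)// (le_trans _ x0)//
      (le_trans u01).
  by move=> [/mem_set -> /mem_set ->].
Qed.

Lemma choquet_one_event h A (u : bool -> R) (p : R) :
  distortion h -> measurable A -> P A = p%:E -> u false <= u true ->
  choquet P h (fun w => u (w \in A)) = u false + h p * (u true - u false).
Proof.
move=> hd mA pE u01.
(* With both events equal to [A], the first and third steps have height zero. *)
rewrite (@choquet_two_events h A A (fun b _ => u b) p p p)//.
- by ring.
- by rewrite setUid.
- by rewrite setIid.
Qed.

Lemma Lfuny_event A (u : bool -> R) : measurable A ->
  (fun w => u (w \in A)) \in Lfun P +oo%E.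
Proof.
move=> mA; apply/LfunyP; split.
  exact: (@measurable_indic_comb A A (fun b _ => u b)).
exists (`|u true| + `|u false|) => //; apply: aeW => w.
by rewrite -ler_norml; case: (w \in A); rewrite ?lerDl ?lerDr.
Qed.

End two_point_variables.

(** * What translation invariance and additive consistency impose on [c] and [h] *)

Section characterizations.
Context d (T : measurableType d) (R : realType) (P : probability T R).
Hypotheses (Pst : standard_space P) (Pat : atomless P).
Variables c h : R -> R.
Hypotheses (uc : utility c) (hd : distortion h).
Implicit Types (X Y Z : T -> R).
Notation rho := (rdeu P c h).

(** The intermediate value theorem gives [p]; the values [h 0 = 0] and [h 1 = 1] keep it off the
    endpoints, as [exists_independent_events] demands. *)
Lemma exists_distortion_level (l : R) : 0 < l < 1 ->
  exists2 p, 0 < p < 1 & h p = l.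
Proof.
move=> /andP[l0 l1]; have [_ hc _ h0 h1] := hd.
have hl : Num.min (h 0) (h 1) <= l <= Num.max (h 0) (h 1).
  by rewrite h0 h1 min_l// max_r// !ltW.
have [p] := IVT ler01 hc hl; rewrite in_itv/= => /andP[p0 p1] hp.
exists p => //; rewrite !lt_neqAle p0 p1 !andbT; apply/andP; split.
- by apply/eqP => p00; move: l0; rewrite -hp -p00 h0 ltxx.
- by apply/eqP => p11; move: l1; rewrite -hp p11 h1 ltxx.
Qed.

Lemma translation_invariant_exponential :
  translation_invariant P rho -> affine_or_exponential c.
Proof.
move=> ti; have [clt _] := uc.
apply: translative_means_exponential => // x y z m xz zy.
have [cxz czy] := (clt _ _ xz, clt _ _ zy).
have cxy := lt_trans cxz czy.
have cyx0 : 0 < c y - c x by rewrite subr_gt0.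
(* This weight places [c z] between [c x] and [c y], so the variable worth [y] with probability [p]
   and [x] otherwise has certainty equivalent [z]. *)
have [p p01 hp] : exists2 p, 0 < p < 1 & h p = (c z - c x) / (c y - c x).
  apply: exists_distortion_level; rewrite divr_gt0 ?subr_gt0//=.
  by rewrite ltr_pdivrMr// mul1r ltrD2r.
have [A [_ [mA _ PA _ _]]] := exists_independent_events Pst Pat p01 p01.
pose X w := if w \in A then y else x.
have LX : X \in Lfun P +oo%E by exact: (Lfuny_event P (fun b : bool => if b
  then y else x)).
have xy : x <= y by rewrite ltW// (lt_trans xz).
have rhoX : rho X = z.
  apply: (utility_inj uc); rewrite utility_rdeu//.
  rewrite (@choquet_one_event _ _ _ P h A (fun b : bool => c (if b then y else
    x)) p)//=.
    by rewrite hp divfK ?lt0r_neq0// addrC subrK.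
  exact: ltW.
have := ti X m LX; rewrite rhoX => /(congr1 c).
rewrite utility_rdeu//; last first.
  exact: (Lfuny_event P (fun b : bool => (if b then y else x) + m)).
rewrite (@choquet_one_event _ _ _ P h A (fun b : bool => c ((if b then y else
  x) + m)) p)//=; last first.
  by rewrite (ltW_homo clt)// lerD2r.
move=> <-; rewrite hp addrC addKr mulrAC divfK// lt0r_neq0//.
Qed.

Lemma exponential_translation_invariant :
  affine_or_exponential c -> translation_invariant P rho.
Proof.
move=> /affine_or_exponentialP[beta [a [b [a0 cE]]]] X m LX.
(* By [expoD], translation by [m] acts on the values of [c] as an affine map, whose slope is
   positive by [expo_factor_gt0]. *)
have cm x : c (x + m) = (1 + beta * expo beta m) * c x +
    (a * expo beta m - b * (beta * expo beta m)).
  by rewrite !cE expoD; ring.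
apply: (utility_inj uc); rewrite utility_rdeu//; last first.
  by have := Lfuny_affine 1 m LX; under eq_fun do rewrite mul1r.
have [mX [M M0 XM]] := (LfunyP P _).1 LX.
have cMM : c (- M) <= c M.
  by have [clt _] := uc; rewrite (ltW_homo clt)// (le_trans _ M0)// oppr_le0.
rewrite cm utility_rdeu// -(choquet_affine _ hd (measurable_utility uc mX) cMM
  (ae_within_utility uc XM))//; last exact: expo_factor_gt0.
by congr choquet; apply/funext => w /=; rewrite cm.
Qed.

(** A constant is independent of every pair. Hence [X] and the constant [rho X], which rank equally,
    still do after adding [m]. *)
Lemma additive_consistent_translation_invariant :
  additive_consistent P rho -> translation_invariant P rho.
Proof.
move=> ac X m LX.
have rk k := rdeu_cst P k uc hd.
have Lk k := Lfuny_cst P k.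
have indep Y W : Y \in Lfun P +oo%E -> W \in Lfun P +oo%E ->
    independent_rv P (fun=> m) (fun w => (Y w, W w)).
  move=> /LfunyP[mY _] /LfunyP[mW _]; apply: independent_rv_cst.
  exact: measurable_fun_pair.
have E1 := ac _ _ _ LX (Lk (rho X)) (Lk m) (indep _ _ LX (Lk _)).
have E2 := ac _ _ _ (Lk (rho X)) LX (Lk m) (indep _ _ (Lk _) LX).
apply/eqP; rewrite eq_le -(rk (rho X + m)).
by apply/andP; split; [apply: E1|apply: E2]; rewrite rk.
Qed.

(** Adding [Z] to [X] and to the constant [rho X] preserves their equal rank, and translation
    invariance extracts the constant. Independence is asked of the pairs [(X w, k)] because the
    comparison variable is constant. *)
Lemma additive_consistent_additive X Z : additive_consistent P rho ->
  X \in Lfun P +oo%E -> Z \in Lfun P +oo%E ->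
  (forall k : R, independent_rv P Z (fun w => (X w, k))) ->
  rho (fun w => X w + Z w) = rho X + rho Z.
Proof.
move=> ac LX LZ indep.
have ti := additive_consistent_translation_invariant ac.
have rk k := rdeu_cst P k uc hd.
have Lk k := Lfuny_cst P k.
have indep' (k : R) : independent_rv P Z (fun w => (k, X w)).
  apply: (independent_rv_comp (f := id) (g :=
    fun p : R * R => (p.2, p.1)) _ _ (indep k)) => //.
  exact: measurable_fun_pair.
rewrite [RHS]addrC -(ti Z (rho X) LZ).
rewrite (_ : (fun w => Z w + rho X) = fun w => rho X + Z w); last first.
  by apply/funext => w; rewrite addrC.
apply/eqP; rewrite eq_le.
have E1 := ac _ _ _ LX (Lk (rho X)) LZ (indep _).
have E2 := ac _ _ _ (Lk (rho X)) LX LZ (indep' _).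
by apply/andP; split; [apply: E1|apply: E2]; rewrite rk.
Qed.

(** Translation invariance first fixes [c] up to a positive affine map; in the coordinate
    [expo beta], additivity on two-valued variables becomes algebraic in the values of [h]. *)
Lemma additive_consistent_distortion_id :
  additive_consistent P rho -> {in `[0, 1], h =1 id}.
Proof.
move=> ac.
have /translation_invariant_exponential/affine_or_exponentialP[beta [a [b [a0
  cE]]]] :=
  additive_consistent_translation_invariant ac.
apply: hosszu_identity => // p q p01 q01.
have [A [B [mA mB PA PB PAB]]] := exists_independent_events Pst Pat p01 q01.
have PAB' : P (A `&` B) = (p * q)%:E by rewrite PAB PA PB.
have PU : P (A `|` B) = (p + q - p * q)%:E.
  rewrite measureUfinl//; last by rewrite ltey_eq fin_num_measure.
  by transitivity (p%:E + q%:E - (p * q)%:E)%E; first congr (_ + _ - _)%E.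
pose e := expo beta.
have e0 : e 0 = 0 by exact: expo0.
have elt x y : x < y -> e x < e y by exact: expo_lt.
(* For X in {0, s} and Z in {0, 1} independent, comparing c (rho (X + Z)) with
   c (rho X + rho Z) gives an equation that is affine in e s. *)
have key s : 1 < s ->
    h (p * q) + h (p + q - p * q) - h p - h q +
    beta * e s * (h (p * q) - h p * h q) = 0.
  move=> s1.
  have s0 := lt_trans ltr01 s1.
  have cle x y : x <= y -> c x <= c y by have [clt _] := uc;
    exact: (ltW_homo clt).
  pose X w : R := if w \in A then s else 0.
  pose Z w : R := if w \in B then 1 else 0.
  have LX : X \in Lfun P +oo%E by exact: (Lfuny_event P (fun b : bool => if b
    then s else 0)).
  have LZ : Z \in Lfun P +oo%E by exact: (Lfuny_event P (fun b : bool => if b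
    then 1 else 0)).
  have indep (k : R) : independent_rv P Z (fun w => (X w, k)).
    apply: (@independent_rv_indicator _ _ _ P _ _ _ _ B A
      (fun b : bool => if b then 1 else 0 : R)
      (fun b : bool => ((if b then s else 0 : R), k))) => //.
    by rewrite setIC PAB muleC.
  have eX : e (rho X) = h p * e s.
    apply: (mulfI (lt0r_neq0 a0)); apply: (addIr b);
      rewrite -[LHS]cE utility_rdeu//.
    rewrite (@choquet_one_event _ _ _ P h A (fun b : bool => c (if b then s
      else 0)) p)//=.
      by rewrite !cE -/e e0; ring.
    by rewrite cle// ltW.
  have eZ : e (rho Z) = h q * e 1.
    apply: (mulfI (lt0r_neq0 a0)); apply: (addIr b);
      rewrite -[LHS]cE utility_rdeu//.
    rewrite (@choquet_one_event _ _ _ P h B (fun b : bool => c (if b then 1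
      else 0)) q)//=.
      by rewrite !cE -/e e0; ring.
    by rewrite cle// ltW.
  have := additive_consistent_additive ac LX LZ indep.
  move=> /(congr1 c); rewrite [in RHS]cE expoD -/e eX eZ utility_rdeu ?LfunyD//.
  (* Since [s > 1], the outcome [A] alone ranks above [B] alone, as the formula requires. *)
  rewrite (@choquet_two_events _ _ _ P h A B (fun b b' : bool =>
    c ((if b then s else 0) + (if b' then 1 else 0)))
    (p + q - p * q) p (p * q))//=; last 3 first.
  - by rewrite cle// add0r ltW.
  - by rewrite cle// add0r addr0 ltW.
  - by rewrite cle// lerD2l ltW.
  rewrite !add0r !addr0 !cE expoD -/e e0 => E.
  have e1 : e 1 != 0 by rewrite gt_eqF// -e0 elt.
  apply: (mulfI (lt0r_neq0 a0)); apply: (mulIf e1); lra.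
(* Two distinct values of [e s] suffice: eliminating the term in [beta] leaves [e 3 - e 2] times the
   defect in the Hosszu equation. *)
have e23 : e 2 < e 3 by apply: elt; lra.
have k2 := key 2 ltac:(lra); have k3 := key 3 ltac:(lra).
have e32 : e 3 - e 2 != 0 by rewrite gt_eqF// subr_gt0.
apply/eqP; rewrite -subr_eq0 opprD addrA; apply/eqP; apply: (mulfI e32).
move: k2 k3; move: (h (p * q) + _ - _ - _) (h (p * q) - _) => E F k2 k3.
transitivity (e 3 * (E + beta * e 2 * F) - e 2 * (E + beta * e 3 * F)).
  by ring.
by rewrite k2 k3 !mulr0 subr0.
Qed.

End characterizations.

Theorem theorem3p3 (R : realType) (d : measure_display) (T : measurableType d)
    (P : probability T R) (Pstandard : standard_space P)
    (Patomless : atomless P) :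
  (forall c h : R -> R, utility c -> distortion h ->
    (translation_invariant P (rdeu P c h) <-> affine_or_exponential c) /\
    (additive_consistent P (rdeu P c h) <->
      (forall x : R, x \in `[0, 1] -> h x = x) /\ affine_or_exponential c)) /\
  (forall rho : (T -> R) -> R,
    (exists c h : R -> R, [/\ utility c, distortion h &
       forall X : T -> R, X \in Lfun P +oo%E -> rho X = rdeu P c h X]) /\
    additive_consistent P rho <->
    exists beta : R,
      forall X : T -> R, X \in Lfun P +oo%E -> rho X = entropic P beta X).
Proof.
(* Additive consistency evaluates a map only at essentially bounded variables and their sums, so
   agreement there is enough. *)
have transfer (rho rho' : (T -> R) -> R) :
    (forall X, X \in Lfun P +oo%E -> rho X = rho' X) ->
    additive_consistent P rho -> additive_consistent P rho'.
  move=> E ac X Y Z LX LY LZ ind XY.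
  by rewrite -!E ?LfunyD//; apply: ac => //; rewrite !E.
split=> [c h uc hd|rho].
  split; split.
  - exact: translation_invariant_exponential.
  - exact: exponential_translation_invariant.
  - move=> ac; split; first exact: additive_consistent_distortion_id ac.
    apply: (translation_invariant_exponential Pstandard Patomless uc hd).
    exact: additive_consistent_translation_invariant.
  - move=> [hid /affine_or_exponentialP[beta [a [b [a0 cE]]]]].
    apply: (transfer _ _ _ (@entropic_additive_consistent _ _ _ P beta)) => X
      LX; symmetry.
    exact: rdeu_entropic cE _ LX.
split=> [[[c [h [uc hd rE]]] ac]|[beta rE]].
  have acr := transfer _ _ rE ac.
  have hid := additive_consistent_distortion_id Pstandard Patomless uc hd acr.
  have /affine_or_exponentialP[beta [a [b [a0 cE]]]] :=
    translation_invariant_exponential Pstandard Patomless uc hd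
      (additive_consistent_translation_invariant uc hd acr).
  exists beta => X LX; rewrite rE//; exact: rdeu_entropic cE _ LX.
split; last first.
  by apply: (transfer _ _ _ (@entropic_additive_consistent _ _ _ P beta)) => X
    LX; rewrite rE.
have idd := distortion_id R.
(* Every entropic measure is itself rank-dependent, with utility [expo beta] and the identity
   distortion. *)
exists (expo beta), id; split => // [|X LX]; first exact: utility_expo.
rewrite rE//; symmetry; apply: (@rdeu_entropic _ _ _ P _ _ beta 1 0) => //.
- exact: utility_expo.
- by move=> x; rewrite mul1r addr0.
Qed.
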